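(* Let $F$ be a field, let $n\ge 1$, let $A = Fe_1\oplus\ldots\oplus Fe_n$ be the direct sum of $n$ copies of $F$, and let $\lambda\in F$, $\lambda\neq0$. The number $r_n$ of orbits of the set of Rota–Baxter operators of weight $\lambda$ on $A$ under the action of the automorphism group $\mathrm{Aut}(A)$ by conjugation, $R\mapsto R^{(\psi)} = \psi^{-1}R\psi$ for $\psi\in\mathrm{Aut}(A)$, equals the number of unlabeled rooted trees on $n+1$ vertices with 2-colored non-root vertices.
   Context: $A = Fe_1\oplus\ldots\oplus Fe_n$ is the $F$-algebra $F^n$ with $e_ie_j=\delta_{ij}e_i$, and $\mathrm{Aut}(A)$ is its group of $F$-algebra automorphisms (it is isomorphic to $S_n$, acting by permutations of $e_1,\ldots,e_n$). A Rota–Baxter operator of weight $\lambda$ on $A$ is an $F$-linear map $R\colon A\to A$ with $R(x)R(y) = R(R(x)y + xR(y) + \lambda xy)$ for all $x,y\in A$. If $R$ is such an operator and $\psi\in\mathrm{Aut}(A)$, then $\psi^{-1}R\psi$ is again a Rota–Baxter operator of weight $\lambda$. ''Unlabeled rooted trees on $n+1$ vertices with 2-colored non-root vertices'' are isomorphism classes of rooted trees with $n+1$ vertices in which each non-root vertex is assigned one of two fixed colors (arbitrarily), where isomorphisms are graph isomorphisms that map root to root and preserve the colors of the non-root vertices. *)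

(* Defs.v *)
From HB Require Import structures.
From mathcomp Require Import all_boot all_fingroup all_algebra all_field.
From mathcomp Require Import boolp classical_sets cardinality.

Set Implicit Arguments.
Unset Strict Implicit.
Unset Printing Implicit Defensive.

Import GRing.Theory.
Local Open Scope ring_scope.

(* F^n with componentwise operations; the regular module F^o (convertible to  *)
(* F) is what makes the library find the F-vector space structure next to the *)
(* ring structure.                                                            *)
Notation sumalg F n := {ffun 'I_n -> F^o}.

Section RotaBaxter.
Variables (F : fieldType) (n : nat).
Local Notation A := (sumalg F n).

Definition rota_baxter (lam : F) (R : 'End(A)) : Prop :=
  forall x y : A, R x * R y = R (R x * y + x * R y + lam *: (x * y)).

(* monoid_morphism: preserves 1 and products. *)
Definition algebra_aut (psi : 'End(A)) : Prop :=
  bijective psi /\ GRing.monoid_morphism psi.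

(* For bijective psi, the library's psi^-1 is the two-sided inverse. *)
Definition rb_conj (R psi : 'End(A)) : 'End(A) := (psi^-1 \o (R \o psi))%VF.

Definition rb_orbit (R : 'End(A)) : set 'End(A) :=
  [set rb_conj R psi | psi in [set psi | algebra_aut psi]]%classic.

Definition rb_orbits (lam : F) : set (set 'End(A)) :=
  [set rb_orbit R | R in [set R | rota_baxter lam R]]%classic.

End RotaBaxter.

(* Raw data of a vertex-coloured rooted graph on the vertex set V: adjacency, *)
(* root, and a partial two-colouring of the vertices (None: not coloured).    *)
Record crgraph (V : finType) := CRGraph {
  adjacency : {set V * V};
  root : V;
  colour : {ffun V -> option bool}
}.

Section CRGraphFinite.
Variable V : finType.

Definition crgraph_code (t : crgraph V) := (adjacency t, root t, colour t).
Definition crgraph_decode c : crgraph V := CRGraph c.1.1 c.1.2 c.2.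
Lemma crgraph_codeK : cancel crgraph_code crgraph_decode.
Proof. by case. Qed.

HB.instance Definition _ := Finite.copy (crgraph V) (can_type crgraph_codeK).

End CRGraphFinite.

Section ColouredTrees.
Variable V : finType.

Definition edge (t : crgraph V) : rel V := fun x y => (x, y) \in adjacency t.

(* The cycles of a simple graph are the duplicate-free closed walks with at   *)
(* least three vertices ([:: x; y] is a ucycle for every edge xy).            *)
Definition is_tree (e : rel V) : Prop :=
  [/\ symmetric e, irreflexive e,
      forall x y, connect e x y
    & forall p : seq V, ucycle e p -> (size p <= 2)%N].

Definition is_coloured_tree (t : crgraph V) : Prop :=
  is_tree (edge t) /\ forall v, (colour t v == None) = (v == root t).

Definition tree_iso (t t' : crgraph V) : bool :=
  [exists f : {perm V},
    [&& f (root t) == root t',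
        [forall x, forall y, edge t' (f x) (f y) == edge t x y]
      & [forall v, (v != root t) ==> (colour t' (f v) == colour t v)]]].

Definition coloured_trees : {set crgraph V} :=
  [set t | `[< is_coloured_tree t >]]%SET.

End ColouredTrees.

(* Every tree with n.+1 vertices is isomorphic to one on 'I_n.+1, with an     *)
(* arbitrary vertex as root, so the unlabeled trees are the isomorphism       *)
(* classes on 'I_n.+1.                                                        *)
Definition num_unlabeled_trees (n : nat) : nat :=
  #|equivalence_partition (@tree_iso 'I_n.+1) (coloured_trees 'I_n.+1)|.

(* Main.v *)
Require Import Defs.
From HB Require Import structures.
From mathcomp Require Import all_boot all_fingroup all_algebra all_field.
From mathcomp Require Import ring.
From mathcomp Require Import boolp classical_sets cardinality.

(** In the basis [e_i], a Rota-Baxter operator of weight [lam] has a matrix   *)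
(** whose [i]-th row has all its entries in [{0, lam}] or all in [{0, -lam}], *)
(** the latter exactly when the diagonal entry is nonzero. The nonzero        *)
(** off-diagonal entries form a strict order in which the elements below a    *)
(** given one are a chain, and conversely any such forest order together with *)
(** any two-colouring (the diagonal) gives an operator. Automorphisms of      *)
(** [F^n] permute the [e_i], so the orbits are the isomorphism classes of     *)
(** coloured forest orders. A rooted tree is recovered from its ancestor      *)
(** order on the non-root vertices: [x] is an ancestor of [y] if [x]          *)
(** dominates [y], i.e. lies on every walk from the root to [y], and the      *)
(** edges of the tree are the covering pairs of that order.                   *)

Set Implicit Arguments.
Unset Strict Implicit.
Unset Printing Implicit Defensive.

Import GRing.Theory.
Local Open Scope ring_scope.
Local Open Scope card_scope.

(** Writing [m i j] for the [j]-th coordinate of [R] at the [i]-th idempotent, the Rota-Baxter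
    identity is a system of quadratic equations in these entries ([rota_baxterP]). Since [lam] is
    nonzero, its solutions are exactly the matrices [rb_coef lam a c] with [a] a forest order and
    [c] an arbitrary colouring ([rb_equations_forest], [forest_rb_equations]), and the zero pattern
    of such a matrix determines [a] off the diagonal and [c] on it. Every automorphism permutes
    coordinates ([algebra_aut_perm]), so two operators share an orbit iff a relabelling of indices
    carries one matrix to the other ([rb_orbitP]). On the graph side, a rooted tree and its
    dominance order determine each other: [tree_cover_graph] recovers the edges from the order,
    while [cover_graph_is_tree] and [cover_dominates] realise every forest order with a least
    element. Hence [tree_op] induces a map from isomorphism classes to orbits that is well defined
    and injective by [tree_iso_orbit], and surjective by [tree_op_surj]. *)

Definition forest_order (T : eqType) (a : rel T) : Prop :=
  [/\ irreflexive a, transitive a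
    & forall x y z, a x z -> a y z -> x != y -> a x y || a y x].

(** * Dominance in rooted graphs *)

Section Dominance.
Variables (V : finType) (e : rel V) (r : V).
Implicit Types (x y z u v : V) (p : seq V).

Definition avoiding x : rel V := fun u v => [&& e u v, u != x & v != x].

(** Strict dominance as in flow graphs. No step of [avoiding r] leaves [r], so the root dominates
    every other vertex; the empty walk keeps the root itself undominated. *)
Definition dominates x y := (x != y) && ~~ connect (avoiding x) r y.

Lemma avoiding_path x u p :
  u != x -> path (avoiding x) u p = path e u p && (x \notin p).
Proof.
elim: p u => [|v p IHp] u ux //=; rewrite {1}/avoiding inE negb_or ux /= (eq_sym x v).
by case: (eqVneq v x) => [|vx] /=; rewrite ?andbF // IHp // andbT andbA.
Qed.

Lemma not_dominatesP x y :
  reflect (x = y \/ exists2 p, path e r p & last r p = y /\ x \notin r :: p)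
          (~~ dominates x y).
Proof.
rewrite /dominates negb_and !negbK.
apply: (iffP orP) => [[/eqP|/connectP[p rp lp]]|[->|[p rp [lp]]]].
- by left.
- have [->|xy] := eqVneq x y; [by left | right; exists p].
    by apply: sub_path rp => u v /and3P[].
  have rx : r != x.
    case: p rp lp => [_ /= yr|v p /=]; first by rewrite -yr eq_sym.
    by case/andP=> /and3P[].
  by move: rp; rewrite avoiding_path // inE eq_sym (negPf rx) => /andP[].
- by left.
rewrite inE negb_or eq_sym => /andP[rx xp]; right; apply/connectP.
by exists p; rewrite ?avoiding_path ?rp.
Qed.

Lemma dominatesP x y :
  reflect (x != y /\ forall p, path e r p -> last r p = y -> x \in r :: p)
          (dominates x y).
Proof.
apply: (iffP idP) => [dom|[xy dom]].
  split=> [|p rp lp]; first by case/andP: dom.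
  by apply: contraLR dom => xp; apply/not_dominatesP; right; exists p.
rewrite -[dominates _ _]negbK; apply/not_dominatesP => -[/eqP|[p rp [lp]]].
  by rewrite (negPf xy).
by rewrite dom.
Qed.

Lemma root_dominates y : y != r -> dominates r y.
Proof.
by move=> yr; apply/dominatesP; rewrite eq_sym; split=> // p _ _; rewrite inE eqxx.
Qed.

Lemma dominates_root x : ~~ dominates x r.
Proof. by rewrite /dominates connect0 andbF. Qed.

Hypothesis e_conn : forall x, connect e r x.

(** A simple walk from the root to [x] would meet [y] earlier, and its prefix ending at [y] misses
    [x]. *)
Lemma dominates_asym x y : dominates x y -> ~~ dominates y x.
Proof.
move=> /dominatesP[xy xdom]; apply/negP => /dominatesP[yx ydom].
have /connectP[p rp lp] := e_conn x.
case/shortenP: rp lp => q rq uq _ lq; have := ydom q rq (esym lq).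
rewrite inE => /orP[/eqP yr|].
  have := xdom [::] isT (esym yr).
  by rewrite inE -yr (negPf xy).
move=> yq; case/path.splitP: yq rq uq lq => q1 q2.
rewrite cat_path -cat_cons cat_uniq last_cat last_rcons.
case/andP=> r1 _ /and3P[_ /hasPn q12 _] lq.
have := xdom _ r1 (last_rcons _ _ _).
have: x \in y :: q2 by rewrite lq mem_last.
by rewrite inE (negPf xy) /= => /q12 /negPf ->.
Qed.

Lemma dominates_trans : transitive dominates.
Proof.
move=> y x z xDy yDz; have := dominates_asym yDz => /negP zNy.
move/dominatesP: (xDy) => [xy xdom]; move/dominatesP: (yDz) => [yz ydom].
apply/dominatesP; split=> [|p rp lp].
  by apply/eqP => xz; apply: zNy; rewrite -xz.
have: y \in r :: p by apply: ydom.
rewrite inE => /orP[/eqP yr|yp].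
  by have := xdom [::] isT (esym yr); rewrite !inE => ->.
case/path.splitP: yp rp lp => p1 p2; rewrite cat_path => /andP[r1 _] _.
have := xdom _ r1 (last_rcons _ _ _).
by rewrite !inE mem_cat => /orP[->//|->]; rewrite orbT.
Qed.

(* The last of two dominators met by a simple path to [z] is reachable from   *)
(* the root without the other, hence so is [z]: this is a contradiction.      *)
Lemma dominates_chain_aux x y p z :
  dominates x z -> ~~ dominates x y -> x != y -> path e r p -> uniq (r :: p) ->
  last r p = z -> y \in p -> (index x (r :: p) < index y (r :: p))%N -> False.
Proof.
move=> xDz /not_dominatesP[xy|[q rq [lq xq]]] + rp up lp yp xiy.
  by rewrite xy eqxx.
move=> xy; case/splitPr: yp rp up lp xiy => p1 p2.
rewrite cat_path last_cat => /andP[r1 yp2].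
rewrite -cat_cons cat_uniq => /and3P[_ /hasPn p12 _] lp xiy.
have yNp1 : y \notin r :: p1 by apply: p12; rewrite inE eqxx.
have xp1 : x \in r :: p1.
  move: xiy; rewrite !index_cat (negPf yNp1) /= eqxx addn0.
  by case: ifP => // _; rewrite ltnNge leq_addr.
have xNp2 : x \notin p2.
  by apply: contraL xp1 => xp2; apply: p12; rewrite inE xp2 orbT.
have /andP[_ {}yp2] : e (last r p1) y && path e y p2 := yp2.
case/dominatesP: xDz => _ /(_ (q ++ p2)).
rewrite cat_path last_cat lq rq yp2 => /(_ isT lp).
by rewrite -cat_cons mem_cat (negPf xq) (negPf xNp2).
Qed.

(** A simple walk to [z] meets both vertices, and the one met first must dominate the other. The
    root is treated apart because [q] lists only the vertices after it. *)
Lemma dominates_chain x y z :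
  dominates x z -> dominates y z -> x != y -> dominates x y || dominates y x.
Proof.
move=> xDz yDz xy; apply/negPn; rewrite negb_or; apply/negP => /andP[xNy yNx].
have [yr|yr] := eqVneq y r.
  by move: yNx; rewrite yr root_dominates // -yr.
have [xr|xr] := eqVneq x r.
  by move: xNy; rewrite xr root_dominates.
have /connectP[p rp lp] := e_conn z; case/shortenP: rp lp => q rq uq _ /esym lq.
have [_ /(_ q rq lq)] := dominatesP _ _ xDz; rewrite inE (negPf xr) /= => xq.
have [_ /(_ q rq lq)] := dominatesP _ _ yDz; rewrite inE (negPf yr) /= => yq.
case: (ltngtP (index x (r :: q)) (index y (r :: q))) => [lt|lt|eq].
- exact: (dominates_chain_aux xDz xNy xy rq uq lq yq lt).
- by apply: (dominates_chain_aux yDz yNx _ rq uq lq xq lt); rewrite eq_sym.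
- have := congr1 (nth r (r :: q)) eq.
  by rewrite !nth_index ?inE ?xq ?yq ?orbT // => /eqP; rewrite (negPf xy).
Qed.

Lemma dominates_forest_order : forest_order dominates.
Proof.
split=> [x||x y z]; [by rewrite /dominates eqxx | exact: dominates_trans |].
exact: dominates_chain.
Qed.

End Dominance.

(** * Tree edges as covering pairs of dominance *)

Definition covers (V : finType) (a : rel V) : rel V :=
  fun x y => a x y && [forall z, a x z ==> ~~ a z y].

Definition cover_graph (V : finType) (a : rel V) : rel V :=
  fun x y => covers a x y || covers a y x.

Section TreeEdges.
Variables (V : finType) (e : rel V) (r : V).
Hypothesis e_tree : is_tree e.

Let e_sym : symmetric e. Proof. by case: e_tree. Qed.
Let e_conn x y : connect e x y. Proof. by case: e_tree. Qed.
Let e_irr x y : e x y -> x != y.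
Proof. by case: e_tree => _ irr _ _; apply: contraTneq => ->; rewrite irr. Qed.

(** Every edge of a tree is a bridge: a simple walk around it, closed up by the edge, would be a
    cycle with at least three vertices. *)
Lemma tree_bridge x y :
  e x y ->
  ~~ connect [rel u v | [&& e u v, (u, v) != (x, y) & (u, v) != (y, x)]] x y.
Proof.
move=> exy; apply/negP => /connectP[p xp lp].
case/shortenP: xp lp => q xq uq _ lq.
have eq : path e x q by apply: sub_path xq => u v /and3P[].
have cyc : ucycle e (x :: q).
  by rewrite /ucycle uq andbT /= rcons_path eq -lq e_sym.
have [_ _ _ /(_ _ cyc)] := e_tree.
case: q xq lq {uq eq cyc} => [|z [|z' q]] //= => [_ yx _ |].
  by move: (e_irr exy); rewrite yx eqxx.
by rewrite andbT => /and3P[_ + _] zy; rewrite zy eqxx.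
Qed.

(** Otherwise the root reaches [y] without [x] and [x] without [y]. Neither walk uses the edge, so
    together they join its ends and contradict [tree_bridge]. *)
Lemma tree_edge_dominates x y : e x y -> dominates e r x y || dominates e r y x.
Proof.
move=> exy; apply/negPn; rewrite negb_or; apply/negP => /andP[].
rewrite /dominates (e_irr exy) eq_sym (e_irr exy) !negbK => xy yx.
case/negP: (tree_bridge exy).
set e' := rel_of_simpl _.
have sub a b : a \in [:: x; y] -> connect (avoiding e a) r b -> connect e' r b.
  move=> ain; apply: connect_sub => u v /and3P[euv ua va]; apply: connect1.
  rewrite /e' /= euv !xpair_eqE.
  by move: ain; rewrite !inE => /orP[]/eqP E; rewrite -E (negPf ua) (negPf va) /= ?andbF.
have e'_sym : connect_sym e'.
  apply: sym_connect_sym => u v; rewrite /e' /= e_sym !xpair_eqE.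
  by rewrite (andbC (v == x)) (andbC (v == y)); congr (_ && _); apply: andbC.
apply: (connect_trans (y := r)).
  by rewrite e'_sym; apply: (sub y) => //; rewrite !inE eqxx orbT.
by apply: (sub x) => //; rewrite !inE eqxx.
Qed.

Lemma dominates_step x y z : e x y -> dominates e r z y -> z != x -> dominates e r z x.
Proof.
move=> exy zDy zx; apply/negPn/negP => /not_dominatesP[/eqP|[p rp [lp zp]]].
  by rewrite (negPf zx).
case/dominatesP: zDy => zy /(_ (rcons p y)).
rewrite rcons_path rp lp exy last_rcons -rcons_cons mem_rcons inE.
by rewrite (negPf zy) (negPf zp) => /(_ isT erefl).
Qed.

Lemma tree_edge_covers x y : e x y -> dominates e r x y -> covers (dominates e r) x y.
Proof.
move=> exy xDy; rewrite /covers xDy /=; apply/forallP => z; apply/implyP => xDz.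
apply/negP => zDy; have zNx := dominates_asym (e_conn r) xDz.
by case/negP: zNx; apply: dominates_step zDy _ => //; rewrite eq_sym; case/andP: xDz.
Qed.

(** The vertex [w] preceding [y] on a simple walk from the root dominates [y]. Were [w] different
    from [x], it would lie strictly between [x] and [y]. *)
Lemma covers_tree_edge x y : covers (dominates e r) x y -> e x y.
Proof.
move=> /andP[xDy /forallP cov].
have /connectP[p rp lp] := e_conn r y; case/shortenP: rp lp => q rq uq _ lq.
case/lastP: q rq uq lq => [_ _ yr|q u].
  by rewrite yr (negPf (dominates_root _ _ _)) in xDy.
rewrite rcons_path last_rcons -rcons_cons rcons_uniq => /andP[rq eqy] /andP[yq uq] yu.
rewrite -yu in eqy yq => {yu}; set w := last r q in eqy.
have [<-//|xw] := eqVneq w x.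
have wDy : dominates e r w y.
  have /orP[//|/dominatesP[_ /(_ q rq erefl)]] := tree_edge_dominates eqy.
  by rewrite (negPf yq).
have xDw : dominates e r x w by apply: dominates_step xDy _ => //; rewrite eq_sym.
by have := cov w; rewrite xDw wDy.
Qed.

Lemma tree_cover_graph : e =2 cover_graph (dominates e r).
Proof.
move=> x y; apply/idP/orP => [exy|[]/covers_tree_edge//]; last by rewrite e_sym.
have /orP[] := tree_edge_dominates exy => D; [left | right]; apply: tree_edge_covers => //.
by rewrite e_sym.
Qed.

End TreeEdges.

(** * The covering graph of a forest order *)

Section CoverGraph.
Variables (V : finType) (a : rel V) (r : V).
Hypothesis a_forest : forest_order a.
Hypothesis a_root : forall x, x != r -> a r x.

Let a_irr : irreflexive a. Proof. by case: a_forest. Qed.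
Let a_trans : transitive a. Proof. by case: a_forest. Qed.
Let a_asym x y : a x y -> a y x = false.
Proof. by move=> xy; apply/negP => /(a_trans xy); rewrite a_irr. Qed.

Lemma covers_unique x x' y : covers a x y -> covers a x' y -> x = x'.
Proof.
move=> /andP[xy /forallP cx] /andP[x'y /forallP cx']; apply/eqP/negPn/negP => xx'.
case: a_forest => _ _ /(_ _ _ _ xy x'y xx')/orP[D|D].
  by have := cx x'; rewrite D x'y.
by have := cx' x; rewrite D xy.
Qed.

Lemma forest_parent y : y != r -> exists x, covers a x y.
Proof.
move=> yr; have [x xy xmax] :=
  @arg_maxnP _ r (a^~ y) (fun x => #|[pred w | a w x]|) (a_root yr).
exists x; rewrite /covers xy; apply/forallP => z; apply/implyP => xz.
apply/negP => /xmax; rewrite /= leqNgt => /negP; apply; apply: proper_card.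
apply/properP; split; last by exists x; rewrite !inE ?a_irr.
by apply/fintype.subsetP => w; rewrite !inE => wx; apply: a_trans xz.
Qed.

(** Descending from [y] through successive parents ends at the root and never leaves the down-closed
    set [P]. *)
Lemma cover_connect (P : pred V) y :
    (forall u v, a u v -> P v -> P u) -> P y ->
  connect [rel u v | [&& cover_graph a u v, P u & P v]] r y.
Proof.
move=> Pdown; have [n] := ubnP #|[pred w | a w y]|.
elim: n y => // n IHn y; rewrite ltnS => le_n Py.
have [->//|/forest_parent[x xCy]] := eqVneq y r.
have xy : a x y by case/andP: xCy.
have Px := Pdown _ _ xy Py.
apply: connect_trans (IHn x _ Px) _; last first.
  by apply: connect1; rewrite /= /cover_graph xCy Px.
apply: leq_trans le_n; apply: proper_card.
apply/properP; split; last by exists x; rewrite !inE ?a_irr.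
by apply/fintype.subsetP => w; rewrite !inE => wx; apply: a_trans xy.
Qed.

Lemma cover_dominates : dominates (cover_graph a) r =2 a.
Proof.
move=> x y; apply/idP/idP => [/andP[xy]|xy].
  apply: contraNT => Naxy.
  (* The elements not above or equal to [x] form a down-closed set; if it contains [y], the descent
     from [y] to the root avoids [x]. *)
  pose P := [pred z | (x != z) && ~~ a x z].
  have: connect [rel u v | [&& cover_graph a u v, P u & P v]] r y.
    apply: cover_connect => [u v uv|]; last by rewrite /P /= xy.
    rewrite /P /= => /andP[xv Nxv]; apply/andP; split.
      by apply: contraNneq Nxv => ->.
    by apply: contra Nxv => /a_trans; apply.
  apply: connect_sub => u v /= /and3P[uv /andP[xu _] /andP[xv _]].
  by apply: connect1; rewrite /avoiding uv !(eq_sym _ x) xu.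
apply/andP; split; first by apply: contraTneq xy => ->; rewrite a_irr.
apply/negP => /connectP[p rp lp].
(* A walk avoiding [x] cannot enter the set of elements above [x]: a covering step upwards into it
   would have to start at [x] or above it. *)
have: ~~ a x (last r p).
  have : ~~ a x r.
    have [->|xr] := eqVneq x r; [by rewrite a_irr | by rewrite a_asym ?a_root].
  elim: p r rp {lp} => //= v p IHp u /andP[/and3P[uv ux vx] vp] xu.
  apply: IHp vp _; apply: contra xu => xv.
  case/orP: uv => /andP[uv /forallP cov]; last exact: a_trans uv.
  case: a_forest => _ _ /(_ x u v xv uv); rewrite eq_sym => /(_ ux)/orP[//|ux'].
  by have := cov x; rewrite ux' xv.
by rewrite -lp xy.
Qed.

Lemma cover_graph_is_tree : is_tree (cover_graph a).
Proof.
have csym : symmetric (cover_graph a) by move=> x y; rewrite /cover_graph orbC.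
split=> // [x|x y|p /andP[cp up]].
- by rewrite /cover_graph /covers a_irr.
- have conn z : connect (cover_graph a) r z.
    have := @cover_connect predT z (fun _ _ _ _ => isT) isT.
    by apply: connect_sub => u v /andP[? _]; apply: connect1.
  by apply: connect_trans (conn y); rewrite (sym_connect_sym csym).
rewrite leqNgt; apply/negP => p3.
have [x0 x0p] : exists x, x \in p.
  by case: p p3 {cp up} => // x p _; exists x; rewrite inE eqxx.
(* At a vertex of the cycle with the largest down-set, both neighbours on the cycle are covered by
   it, so they coincide by [covers_unique]. *)
have [y yp ymax] := @arg_maxnP _ x0 (mem p) (fun x => #|[pred w | a w x]|) x0p.
have nay z : z \in p -> a y z = false.
  move=> /ymax; rewrite /= leqNgt; apply: contraNF => yz; apply: proper_card.
  apply/properP; split; last by exists y; rewrite !inE ?a_irr.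
  by apply/fintype.subsetP => w; rewrite !inE => wx; apply: a_trans yz.
have below z : z \in p -> cover_graph a y z -> covers a z y.
  by move=> zp /orP[/andP[]|//]; rewrite nay.
have [i q E] := rot_to yp.
have {}below z : z \in y :: q -> cover_graph a y z -> covers a z y.
  by rewrite -E mem_rot; apply: below.
move: up cp p3; rewrite -(rot_uniq i) -(rot_cycle i) -(size_rot i) E.
case/lastP: q below {E} => [//|[//|u q] v] below /=.
rewrite !rcons_path last_rcons => /and3P[_ uNq _] /and3P[yu _ vy] _.
have uv : u = v.
  apply: (@covers_unique _ _ y); apply: below => //.
  - by rewrite !inE eqxx orbT.
  - by rewrite !inE mem_rcons inE eqxx !orbT.
  - by rewrite csym.
by move: uNq; rewrite uv mem_rcons inE eqxx.
Qed.

End CoverGraph.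

(** * Matrices of Rota-Baxter operators *)

Section Coefficients.
Variables (F : fieldType) (n : nat).
Local Notation A := (sumalg F n).
Implicit Types (x y : A) (i j k l : 'I_n) (R : 'End(A)) (m : 'I_n -> 'I_n -> F).

Definition basis_vec i : A := [ffun j => (j == i)%:R].
Definition coef R i j : F := R (basis_vec i) j.

Lemma sumalg_mulE x y i : (x * y) i = x i * y i.
Proof. by rewrite ffunE. Qed.

Lemma sumalg_scaleE (a : F) x i : (a *: x) i = a * x i.
Proof. by rewrite ffunE. Qed.

Lemma sumalg_sum_basis x : x = \sum_i x i *: basis_vec i.
Proof.
apply/ffunP => j; rewrite sum_ffunE (bigD1 j) //= big1 => [|i ij]; rewrite !ffunE.
  by rewrite eqxx addr0 [RHS]mulr1.
by rewrite eq_sym (negPf ij) [LHS]mulr0.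
Qed.

Lemma lfun_coefE R x l : R x l = \sum_i x i * coef R i l.
Proof.
rewrite {1}(sumalg_sum_basis x) linear_sum sum_ffunE; apply: eq_bigr => i _.
by rewrite linearZ sumalg_scaleE.
Qed.

Lemma coef_inj R R' : (forall i j, coef R i j = coef R' i j) -> R = R'.
Proof.
move=> eqR; apply/lfunP => x; apply/ffunP => l; rewrite !lfun_coefE.
by apply: eq_bigr => i _; rewrite eqR.
Qed.

Definition op_fun m x : A := [ffun l => \sum_i x i * m i l].

Lemma op_fun_linear m : linear (op_fun m).
Proof.
move=> a x y; apply/ffunP => l; rewrite !ffunE scaler_sumr -big_split /=.
by apply: eq_bigr => i _; rewrite !ffunE mulrDl [in LHS]/GRing.scale /= -mulrA.
Qed.

HB.instance Definition _ m := GRing.isLinear.Build F A A _ (op_fun m) (op_fun_linear m).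

Definition op m : 'End(A) := linfun (op_fun m).

Lemma opE m x l : op m x l = \sum_i x i * m i l.
Proof. by rewrite lfunE ffunE. Qed.

Lemma sum_delta i (f : 'I_n -> F) : \sum_j (j == i)%:R * f j = f i.
Proof.
rewrite (bigD1 i) //= eqxx mul1r big1 ?addr0 // => j /negPf ->.
by rewrite mul0r.
Qed.

Lemma coef_op m i j : coef (op m) i j = m i j.
Proof.
rewrite /coef opE -(sum_delta i (m^~ j)).
by apply: eq_bigr => k _; rewrite ffunE.
Qed.

Definition rb_equations (lam : F) m := forall i j l,
  m i l * m j l = m i j * m j l + m j i * m i l + (i == j)%:R * lam * m i l.

(** Both sides of the identity are bilinear in [x] and [y], so it suffices to compare coordinates on
    pairs of basis vectors. *)
Lemma rota_baxterP (lam : F) R : rota_baxter lam R <-> rb_equations lam (coef R).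
Proof.
split=> [rb i j l|rb x y].
  have := rb (basis_vec i) (basis_vec j).
  have -> : R (basis_vec i) * basis_vec j = coef R i j *: basis_vec j.
    apply/ffunP => k; rewrite sumalg_mulE sumalg_scaleE ffunE.
    by case: eqVneq => [->//|_]; rewrite !mulr0.
  have -> : basis_vec i * R (basis_vec j) = coef R j i *: basis_vec i.
    apply/ffunP => k; rewrite sumalg_mulE sumalg_scaleE ffunE mulrC.
    by case: eqVneq => [->//|_]; rewrite !mulr0.
  have -> : basis_vec i * basis_vec j = (i == j)%:R *: basis_vec i.
    apply/ffunP => k; rewrite sumalg_mulE sumalg_scaleE !ffunE mulrC.
    by case: (eqVneq k i) => [->//|_]; rewrite !mulr0.
  move/ffunP/(_ l); rewrite scalerA !linearD !linearZ sumalg_mulE 2![in RHS]ffunE.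
  by rewrite !sumalg_scaleE => ->; rewrite (mulrC lam).
apply/ffunP => l; rewrite sumalg_mulE !lfun_coefE mulr_suml.
under eq_bigr => i _ do rewrite mulr_sumr.
have -> : \sum_i \sum_j x i * coef R i l * (y j * coef R j l) =
    \sum_i \sum_j (x i * coef R i j * (y j * coef R j l)
      + x i * (y j * coef R j i) * coef R i l
      + (j == i)%:R * (lam * (x i * y j) * coef R i l)).
  apply: eq_bigr => i _; apply: eq_bigr => j _.
  have := rb i j l; rewrite (eq_sym j) => E.
  transitivity (x i * y j * (coef R i l * coef R j l)); first by ring.
  by rewrite E; ring.
under eq_bigr => i _ do
  rewrite !big_split /= (sum_delta i (fun j => lam * (x i * y j) * coef R i l)).
rewrite !big_split /= exchange_big /=.
rewrite -!big_split /=; apply: eq_bigr => i _.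
rewrite 2![in RHS]ffunE sumalg_scaleE !sumalg_mulE !lfun_coefE !mulrDl.
by congr (_ + _ + _); rewrite ?mulr_suml ?mulr_sumr ?mulr_suml; apply: eq_bigr => j _; ring.
Qed.

Definition rb_coef (lam : F) (a : rel 'I_n) (c : pred 'I_n) i j : F :=
  lam * (-1) ^+ c i * (if i == j then c i else a i j)%:R.

Lemma forest_rb_equations (lam : F) (a : rel 'I_n) (c : pred 'I_n) :
  forest_order a -> rb_equations lam (rb_coef lam a c).
Proof.
case=> a_irr a_trans a_chain i j l; rewrite /rb_coef.
have [<-|ij] /= := eqVneq i j.
  case: (c i) => /=; rewrite ?expr0 ?expr1.
    by case: (if _ then _ else _) => /=; ring.
  by case: (if _ then _ else _) => /=; ring.
set b := fun i j => if i == j then c i else a i j.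
(* The equation for distinct [i], [j] stripped of signs and of [lam]: when both [b i l] and [b j l]
   hold, exactly one of [a i j], [a j i] holds; in the other cases both sides vanish. *)
have {a_irr a_trans a_chain}:
    (b i l && b j l)%:R = (a i j && b j l)%:R + (a j i && b i l)%:R :> F.
  have /negPf Nij : ~~ (a i j && a j i).
    by apply/negP => /andP[/a_trans ij' /ij']; rewrite a_irr.
  rewrite /b; have [<-|il] := eqVneq i l.
    by rewrite eq_sym (negPf ij) Nij add0r andbC.
  have [<-|jl] := eqVneq j l; first by rewrite (andbC (a j i)) Nij addr0.
  move: (a_chain i j l) (a_trans j i l) (a_trans i j l) Nij.
  case: (a i l) => //=; case: (a j l) => //=;
    case: (a i j) => //=; case: (a j i) => //=;
    rewrite ?addr0 ?add0r //.
  - by move/(_ isT isT ij).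
  - by move=> _ _ /(_ isT isT).
  by move=> _ /(_ isT isT).
rewrite -!mulnb !natrM -/(b i l) -/(b j l) => E.
transitivity (lam ^+ 2 * (-1) ^+ c i * (-1) ^+ c j * ((b i l)%:R * (b j l)%:R)).
  by ring.
by rewrite E; ring.
Qed.

(** For distinct indices, the equation at [(i, j, j)] gives antisymmetry and the one at [(i, j, k)]
    gives transitivity and the chain condition. The equations with [i = j] give the values: a
    nonzero diagonal entry is [- lam], and any nonzero entry of row [i] is [m i i + m i i + lam]. *)
Lemma rb_equations_forest (lam : F) m : lam != 0 -> rb_equations lam m ->
  exists a c, forest_order a /\ forall i j, m i j = rb_coef lam a c i j.
Proof.
move=> lam0 rb.
pose a : rel 'I_n := fun i j => (i != j) && (m i j != 0).
pose c : pred 'I_n := fun i => m i i != 0.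
have m_asym i j : i != j -> m i j * m j i = 0.
  move=> ij; have := rb i j j; rewrite (negPf ij) !mul0r addr0 => E.
  by apply: (addrI (m i j * m j j)); rewrite addr0 [m i j * m j i]mulrC -E.
exists a, c; split; first split.
- by move=> i; rewrite /a eqxx.
- move=> j i k /andP[ij mij] /andP[jk mjk].
  have mji : m j i = 0.
    by have /eqP := m_asym i j ij; rewrite mulf_eq0 (negPf mij) => /eqP.
  have ik : i != k.
    by apply: contraNneq mjk => <-; rewrite mji.
  rewrite /a ik /=; have := rb i j k; rewrite mji (negPf ij) !mul0r !addr0.
  by move/(mulIf mjk) => ->.
- move=> i j k /andP[_ mik] /andP[_ mjk] ij; rewrite /a (eq_sym j) ij /=.
  have := rb i j k; rewrite (negPf ij) !mul0r addr0 => E.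
  have : m i k * m j k != 0 by rewrite mulf_neq0.
  rewrite E; apply: contraNT; rewrite negb_or !negbK => /andP[/eqP-> /eqP->].
  by rewrite !mul0r addr0.
move=> i j; rewrite /rb_coef /a /c.
have mii : m i i != 0 -> m i i = - lam.
  move=> nz; apply: (mulfI nz).
  have := rb i i i; rewrite eqxx mul1r => E.
  apply/eqP; rewrite -subr_eq0 -(subrr (m i i * m i i)) {2}E; apply/eqP; ring.
have mij : m i j != 0 -> m i j = m i i + m i i + lam.
  by move=> nz; apply: (mulIf nz); rewrite rb eqxx mul1r !mulrDl.
case: (eqVneq i j) => [<-|ij] /=.
  by case: eqVneq => [->|/mii ->] /=; rewrite ?mulr0 // expr1 mulr1 mulrN1.
have [->|/mij ->] := eqVneq (m i j) 0; first by rewrite mulr0.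
by case: eqVneq => [->|/mii ->] /=; rewrite ?expr0 ?expr1; ring.
Qed.

Lemma rb_coef_neq0 (lam : F) (a : rel 'I_n) (c : pred 'I_n) i j :
  lam != 0 -> (rb_coef lam a c i j != 0) = (if i == j then c i else a i j).
Proof.
move=> lam0; rewrite /rb_coef !mulf_eq0 (negPf lam0) signr_eq0 /=.
by case: (if _ then _ else _); rewrite ?oner_eq0 ?eqxx.
Qed.

End Coefficients.

(** * Automorphisms and orbits *)

Section Automorphisms.
Variables (F : fieldType) (n : nat).
Local Notation A := (sumalg F n).
Implicit Types (x y : A) (i j k l : 'I_n) (R psi : 'End(A)) (t : 'S_n).

Definition perm_op t : 'End(A) := op (fun i k => (i == t k)%:R).

Lemma perm_opE t x k : perm_op t x k = x (t k).
Proof.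
by rewrite opE -(sum_delta (t k) x); apply: eq_bigr => i _; rewrite mulrC.
Qed.

Lemma perm_op_aut t : algebra_aut (perm_op t).
Proof.
split.
  exists (perm_op t^-1) => x; apply/ffunP => k; rewrite !perm_opE.
    by rewrite permKV.
  by rewrite permK.
split=> [|x y]; apply/ffunP => k; first by rewrite perm_opE !ffunE.
by rewrite perm_opE !sumalg_mulE !perm_opE.
Qed.

(** Each coordinate of [psi] is a unital multiplicative functional, hence evaluation at some index
    [f k]. Injectivity of [psi] makes [f] surjective, thus a permutation. *)
Lemma algebra_aut_perm psi : algebra_aut psi -> exists t, psi = perm_op t.
Proof.
case=> psi_bij [psi1 psiM].
have hit k : exists i, psi (basis_vec F i) k == 1.
  have [i nz] : exists i, psi (basis_vec F i) k != 0.
    apply/existsP; rewrite -[[exists _, _]]negbK negb_exists.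
    apply/negP => /forallP z.
    have := congr1 (fun x : A => x k) psi1; rewrite lfun_coefE big1 ?ffunE.
      by move/esym/eqP; rewrite oner_eq0.
    by move=> i _; have := z i; rewrite negbK /coef => /eqP ->; rewrite mulr0.
  (* The coordinate is a nonzero idempotent of the field, hence equal to 1. *)
  exists i; apply/eqP/(mulfI nz); rewrite mulr1 -sumalg_mulE -psiM.
  congr (psi _ k); apply/ffunP => j; rewrite sumalg_mulE !ffunE.
  by case: eqP => _; rewrite ?mulr0 ?mulr1.
pose f k := xchoose (hit k).
have psiE x k : psi x k = x (f k).
  have /eqP fk := xchooseP (hit k).
  rewrite -[LHS]mulr1 -fk -/(f k) -sumalg_mulE -psiM.
  have -> : x * basis_vec F (f k) = x (f k) *: basis_vec F (f k).
    apply/ffunP => j; rewrite sumalg_mulE sumalg_scaleE !ffunE.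
    by case: eqP => [->//|_]; rewrite !mulr0.
  by rewrite linearZ sumalg_scaleE fk mulr1.
have f_surj i : i \in codom f.
  apply/negPn/negP => iNf.
  have : psi (basis_vec F i) = psi 0.
    apply/ffunP => k; rewrite !psiE !ffunE; case: eqP => // fk.
    by case/negP: iNf; rewrite -fk codom_f.
  move/(bij_inj psi_bij)/ffunP/(_ i); rewrite !ffunE eqxx => /eqP.
  by rewrite oner_eq0.
have f_inj : injective f.
  apply/injectiveP/card_uniqP; rewrite size_map -cardT.
  by apply: eq_card => i; rewrite f_surj.
exists (perm f_inj); apply/lfunP => x; apply/ffunP => k.
by rewrite perm_opE psiE permE.
Qed.

Lemma perm_op_conj R R' t :
  R' = rb_conj R (perm_op t) <-> forall i k, coef R' (t i) (t k) = coef R i k.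
Proof.
have ker0 : lker (perm_op t) == 0%VS.
  by apply/lker0P/bij_inj; case: (perm_op_aut t).
have perm_basis i : perm_op t (basis_vec F (t i)) = basis_vec F i.
  by apply/ffunP => k; rewrite perm_opE !ffunE (inj_eq perm_inj).
transitivity ((perm_op t \o R')%VF = (R \o perm_op t)%VF).
  split=> [->|E]; first by rewrite /rb_conj lker0_compVKf.
  by rewrite /rb_conj -E lker0_compKf.
split=> [E i k|E].
  have := congr1 (fun g : 'End(A) => g (basis_vec F (t i)) k) E.
  by rewrite !lfunE /= perm_opE perm_basis.
apply/coef_inj => i k; rewrite /coef !lfunE /= perm_opE.
by rewrite -[i](permKV t) perm_basis; apply: E.
Qed.

Lemma rb_orbitP R R' :
  rb_orbit R R' <-> exists t, forall i k, coef R' (t i) (t k) = coef R i k.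
Proof.
split=> [[psi aut <-]|[t /perm_op_conj ->]]; last first.
  by exists (perm_op t) => //; apply: perm_op_aut.
have [t ->] := algebra_aut_perm aut.
by exists t; apply/perm_op_conj.
Qed.

Lemma rb_orbit_eq R R' : rb_orbit R = rb_orbit R' <-> rb_orbit R R'.
Proof.
split=> [->|/rb_orbitP[t E]]; first by apply/rb_orbitP; exists 1%g => i k; rewrite !perm1.
apply/seteqP; split=> S /rb_orbitP[s H]; apply/rb_orbitP.
  by exists (t^-1 * s)%g => i k; rewrite !permM H -E !permKV.
by exists (t * s)%g => i k; rewrite !permM H E.
Qed.

End Automorphisms.

(** * From trees to orbits *)

Section Transport.
Variable V : finType.
Implicit Types (e a : rel V) (f : {perm V}) (x y : V).

Lemma connect_perm e e' f : (forall x y, e' (f x) (f y) = e x y) ->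
  forall x y, connect e' (f x) (f y) = connect e x y.
Proof.
have homo e1 e2 (g : V -> V) : (forall x y, e1 x y -> e2 (g x) (g y)) ->
    forall x y, connect e1 x y -> connect e2 (g x) (g y).
  move=> eg x y /connectP[p xp ->]; apply/connectP; exists (map g p).
    exact: homo_path xp.
  by rewrite last_map.
move=> ee' x y; apply/idP/idP; last by apply: homo => u v; rewrite ee'.
rewrite -{2}[x](permK f) -{2}[y](permK f); apply: homo => u v.
by rewrite -ee' !permKV.
Qed.

Lemma dominates_perm e e' f r : (forall x y, e' (f x) (f y) = e x y) ->
  forall x y, dominates e' (f r) (f x) (f y) = dominates e r x y.
Proof.
move=> ee' x y; rewrite /dominates (inj_eq perm_inj); congr (_ && ~~ _).
by apply: connect_perm => u v; rewrite /avoiding ee' !(inj_eq perm_inj).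
Qed.

Lemma cover_graph_perm a a' f : (forall x y, a' (f x) (f y) = a x y) ->
  forall x y, cover_graph a' (f x) (f y) = cover_graph a x y.
Proof.
move=> aa'; have cov x y : covers a' (f x) (f y) = covers a x y.
  rewrite /covers aa'; congr (_ && _); apply/forallP/forallP => H z.
    by have := H (f z); rewrite !aa'.
  by have := H (f^-1%g z); rewrite -!aa' !permKV.
by move=> x y; rewrite /cover_graph !cov.
Qed.

End Transport.

Lemma forest_order_inj (S T : eqType) (g : S -> T) (a : rel T) :
  injective g -> forest_order a -> forest_order (fun x y => a (g x) (g y)).
Proof.
move=> g_inj [irr tr chain]; split=> [x|y x z|x y z xz yz xy]; rewrite ?irr //.
  exact: tr.
by apply: chain xz yz _; rewrite (inj_eq g_inj).
Qed.

Lemma perm_lift_perm n (f : 'S_n.+1) (r : 'I_n.+1) :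
  exists s : 'S_n, f = lift_perm r (f r) s.
Proof.
have lift_ex i : exists j, f (lift r i) == lift (f r) j.
  have : f r != f (lift r i) by rewrite (inj_eq perm_inj) neq_lift.
  by case/unlift_some => j -> _; exists j.
pose g i := xchoose (lift_ex i).
have gE i : f (lift r i) = lift (f r) (g i) by apply/eqP/(xchooseP (lift_ex i)).
have g_inj : injective g.
  by move=> i j eqg; apply/(@lift_inj _ r)/(@perm_inj _ f); rewrite !gE eqg.
exists (perm g_inj); apply/permP => x.
by case: (unliftP r x) => [i|] ->; rewrite ?lift_perm_id // lift_perm_lift permE gE.
Qed.

Local Notation root := Defs.root.

(** * The bijection between coloured trees and orbits *)

Section TreeOperators.
Variables (F : fieldType) (n : nat) (lam : F).
Hypothesis lam_neq0 : lam != 0.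
Local Notation A := (sumalg F n).
Implicit Types (t : crgraph 'I_n.+1) (R : 'End(A)).

Definition tree_order t : rel 'I_n := fun i j =>
  dominates (edge t) (root t) (lift (root t) i) (lift (root t) j).

Definition tree_colour t : pred 'I_n := fun i => colour t (lift (root t) i) == Some true.

Definition tree_op t : 'End(A) := op (rb_coef lam (tree_order t) (tree_colour t)).

Lemma tree_op_rota_baxter t : is_coloured_tree t -> rota_baxter lam (tree_op t).
Proof.
case=> -[_ _ conn _] _; apply/rota_baxterP => i j l; rewrite !coef_op.
apply: forest_rb_equations; apply: forest_order_inj; first exact: lift_inj.
by apply: dominates_forest_order => x.
Qed.

Lemma coloured_nonroot t i : is_coloured_tree t ->
  colour t (lift (root t) i) = Some (tree_colour t i).
Proof.
case=> _ /(_ (lift (root t) i)).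
rewrite eq_sym (eq_sym _ (root t)) (negPf (neq_lift _ _)).
by rewrite /tree_colour; case: (colour t _) => [[]|].
Qed.

Lemma tree_iso_orbit t t' : is_coloured_tree t -> is_coloured_tree t' ->
  tree_iso t t' <-> rb_orbit (tree_op t) (tree_op t').
Proof.
move=> tt tt'; split.
  case/existsP=> f /and3P[/eqP froot fedge fcol].
  have [s fs] := perm_lift_perm f (root t); rewrite froot in fs.
  apply/rb_orbitP; exists s => i k; rewrite !coef_op /rb_coef.
  have fl j : lift (root t') (s j) = f (lift (root t) j) by rewrite fs lift_perm_lift.
  have -> : tree_colour t' (s i) = tree_colour t i.
    rewrite /tree_colour fl; congr (_ == _); apply/eqP.
    by have /forallP/(_ (lift (root t) i)) := fcol; rewrite eq_sym neq_lift.
  have -> : tree_order t' (s i) (s k) = tree_order t i k.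
    rewrite /tree_order !fl -froot; apply: dominates_perm => x y.
    by have /forallP/(_ x)/forallP/(_ y)/eqP := fedge.
  by rewrite (inj_eq perm_inj).
case/rb_orbitP=> s sE.
(* Only the zero pattern of the matrices is kept: its diagonal is the colouring and the rest is the
   order. *)
have {}sE i k : (if i == k then tree_colour t' (s i) else tree_order t' (s i) (s k))
              = (if i == k then tree_colour t i else tree_order t i k).
  have := congr1 (fun z => z != 0) (sE i k).
  by rewrite !coef_op !rb_coef_neq0 // (inj_eq perm_inj).
pose f := lift_perm (root t) (root t') s.
have froot : f (root t) = root t' by rewrite lift_perm_id.
have fl j : f (lift (root t) j) = lift (root t') (s j) by rewrite lift_perm_lift.
have fdom x y : dominates (edge t') (root t') (f x) (f y)
              = dominates (edge t) (root t) x y.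
  case: (unliftP (root t) y) => [j|] ->; last first.
    by rewrite froot !(negPf (dominates_root _ _ _)).
  case: (unliftP (root t) x) => [i|] ->; last first.
    by rewrite froot fl !root_dominates // eq_sym neq_lift.
  rewrite !fl; have := sE i j; case: eqVneq => [->|_] // _.
  by rewrite /dominates !eqxx.
apply/existsP; exists f; rewrite froot eqxx /=; apply/andP; split.
  apply/forallP => x; apply/forallP => y; apply/eqP.
  rewrite (tree_cover_graph (root t') tt'.1) (tree_cover_graph (root t) tt.1).
  exact: cover_graph_perm.
apply/forallP => v; apply/implyP.
case: (unliftP (root t) v) => [i|] ->; last by rewrite eqxx.
by rewrite fl !coloured_nonroot // => _; have := sE i i; rewrite eqxx => ->.
Qed.

(** The new least element [ord0] joins the forest into a single tree and serves as its root. *)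
Definition add_bottom (a : rel 'I_n) : rel 'I_n.+1 := fun x y =>
  match unlift ord0 x, unlift ord0 y with
  | None, Some _ => true
  | Some i, Some j => a i j
  | _, None => false
  end.

Lemma add_bottom_forest a : forest_order a -> forest_order (add_bottom a).
Proof.
case=> irr tr chain; rewrite /add_bottom; split.
- by move=> x; case: (unlift _ x).
- move=> y x z; case: (unlift _ x) => [i|]; case: (unlift _ y) => [j|] //;
    case: (unlift _ z) => [k|] //; exact: tr.
move=> x y z; case: (unliftP ord0 x) => [i|] ->; case: (unliftP ord0 y) => [j|] ->;
  case: (unlift _ z) => [k|] //.
move=> ik jk; rewrite (inj_eq lift_inj); exact: chain ik jk.
Qed.

Lemma add_bottom_root a x : x != ord0 -> add_bottom a ord0 x.
Proof.
rewrite /add_bottom unlift_none; by case: (unliftP ord0 x) => [i|] ->.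
Qed.

Lemma tree_op_surj R : rota_baxter lam R -> exists2 t, is_coloured_tree t & R = tree_op t.
Proof.
move=> /rota_baxterP rb; have [a [c [a_forest RE]]] := rb_equations_forest lam_neq0 rb.
have b_forest := add_bottom_forest a_forest.
pose t := CRGraph [set p | cover_graph (add_bottom a) p.1 p.2] ord0
            [ffun v => omap c (unlift ord0 v)].
have tE : edge t = cover_graph (add_bottom a).
  by apply/funext => x; apply/funext => y; rewrite /edge inE.
exists t.
  split; first by rewrite tE; exact: cover_graph_is_tree (@add_bottom_root a).
  move=> v; rewrite ffunE; case: unliftP => [i|] ->; last by rewrite eqxx.
  by apply/esym/negbTE; rewrite eq_sym neq_lift.
apply/coef_inj => i j; rewrite RE coef_op /rb_coef.
have -> k : tree_colour t k = c k.
  by rewrite /tree_colour ffunE liftK /=; case: (c k).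
have -> // : tree_order t i j = a i j.
rewrite /tree_order tE (cover_dominates b_forest (@add_bottom_root a)).
by rewrite /add_bottom !liftK.
Qed.

Lemma mem_coloured_trees t : t \in coloured_trees 'I_n.+1 -> is_coloured_tree t.
Proof. by rewrite inE => /asboolP. Qed.

Lemma tree_isoE : {in coloured_trees 'I_n.+1 &, forall t t',
  tree_iso t t' <-> rb_orbit (tree_op t) = rb_orbit (tree_op t')}.
Proof.
move=> t t' /mem_coloured_trees tt /mem_coloured_trees tt'.
by rewrite rb_orbit_eq; apply: tree_iso_orbit.
Qed.

(** Inherited from equality of orbits through [tree_isoE]. *)
Lemma tree_iso_equivalence :
  {in coloured_trees 'I_n.+1 & &, equivalence_rel (@tree_iso 'I_n.+1)}.
Proof.
move=> t u v tT uT vT; split; first by apply/tree_isoE.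
move/(tree_isoE tT uT) => E; apply/idP/idP.
  by move/(tree_isoE tT vT) => H; apply/(tree_isoE uT vT); rewrite -E.
by move/(tree_isoE uT vT) => H; apply/(tree_isoE tT vT); rewrite E.
Qed.

Lemma card_rb_orbits : @rb_orbits F n lam #= `I_(num_unlabeled_trees n).
Proof.
pose D := coloured_trees 'I_n.+1; pose P := equivalence_partition (@tree_iso _) D.
have PD : finset.partition P D by apply/equivalence_partitionP/tree_iso_equivalence.
have XP := transversalP PD; set X := transversal P D in XP.
have XD : {subset X <= D} by apply/fintype.subsetP/(transversal_sub XP).
have isoP : {in D &, forall t u, (u \in finset.pblock P t) = tree_iso t u}.
  exact: pblock_equivalence_partition tree_iso_equivalence.
have DX t : t \in D -> exists2 u, u \in X & tree_iso t u.
  move=> tD; have : finset.pblock P t \in finset.pblock P @: X.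
    by rewrite (pblock_transversal XP) finset.pblock_mem // (cover_partition PD).
  case/imsetP => u uX E; exists u => //.
  rewrite -(isoP _ _ tD (XD _ uX)) E.
  by rewrite mem_pblock (cover_partition PD) XD.
pose t0 : crgraph 'I_n.+1 := CRGraph finset.set0 ord0 [ffun=> None].
(* [X] holds one tree from each isomorphism class, so [h] enumerates the orbits without repetition;
   the default [t0] is never reached for indices below [#|X|]. *)
pose h k := rb_orbit (tree_op (nth t0 (enum X) k)).
have sX : #|X| = num_unlabeled_trees n by rewrite (card_transversal XP).
have -> : @rb_orbits F n lam = (h @` `I_(num_unlabeled_trees n))%classic.
  apply/seteqP; split=> [_ [R /= /tree_op_surj[t tt ->] <-]|_ [k /= kX <-]].
    have tD : t \in D by rewrite inE; apply/asboolP.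
    have [u uX /(tree_isoE tD (XD _ uX)) E] := DX t tD.
    exists (index u (enum X)); first by rewrite /= -sX cardE index_mem mem_enum.
    by rewrite /h nth_index ?mem_enum.
  exists (tree_op (nth t0 (enum X) k)) => //.
  apply/tree_op_rota_baxter/mem_coloured_trees/XD.
  by rewrite -mem_enum mem_nth // -cardE sX.
apply: inj_card_eq => i j; rewrite !inE -!sX => iX jX; rewrite /h.
have nX k : (k < #|X|)%N -> nth t0 (enum X) k \in X.
  by move=> kX; rewrite -mem_enum mem_nth // -cardE.
move/(tree_isoE (XD _ (nX _ iX)) (XD _ (nX _ jX))).
rewrite -(isoP _ _ (XD _ (nX _ iX)) (XD _ (nX _ jX))) => ij.
have E := same_pblock (partition_trivIset PD) ij.
have /eqP := pblock_inj XP (nX _ iX) (nX _ jX) (esym E).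
by rewrite nth_uniq -?cardE ?enum_uniq // => /eqP.
Qed.

End TreeOperators.

(* `I_k = {0, ..., k-1}: the set of orbits is finite, of cardinality k. *)
Theorem mainTheorem3 (F : fieldType) (n : nat) (lam : F)
    (n_ge1 : (1 <= n)%N) (lam_neq0 : lam != 0) :
  @rb_orbits F n lam #= `I_(num_unlabeled_trees n).
Proof. exact: card_rb_orbits. Qed.
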